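(* Let $\mathfrak{I}$ be a loopblind interaction family. For any hypergraph $G=(V,E)$, there exists a loopless hypergraph $\overline{G}$ such that $$p(\boldsymbol{s}\mid\mathcal{M}(G;\mathfrak{I}),\boldsymbol{g})=p(\boldsymbol{s}\mid\mathcal{M}(\overline{G};\mathfrak{I}),\boldsymbol{g})$$ for all $\boldsymbol{s}$ and $\boldsymbol{g}$.
   Context: A hypergraph $G=(V,E)$ consists of a set $V$ of vertices and a multiset $E$ of hyperedges, each of which is a multiset of elements of $V$ (repeated and empty hyperedges are allowed). A loop is a hyperedge in which some vertex appears more than once; a hypergraph is loopless if it contains no loops. An interaction family $\mathfrak{I}=(S,\{\Phi^k\}_{k\in\mathbb{Z}_{\ge0}})$ consists of a finite set $S$ (the spin value set) and functions $\Phi^k\colon S^k\to\mathbb{C}$, each invariant under permutation of its $k$ arguments. For a multiset $A$ of indices, $|A|$ is counted with multiplicity, $\boldsymbol{s}|_A$ denotes the multiset of values $s_i$, $i\in A$ (with multiplicity), and $\Phi^{|A|}(\boldsymbol{s}|_A)$ denotes $\Phi^{|A|}$ applied to these values. The model $\mathcal{M}(G;\mathfrak{I})$ induced by $\mathfrak{I}$ on $G$ has state space $S^{|V|}$ and, for each $e\in E$, the interaction function $\phi^e(\boldsymbol{s})=\Phi^{|e|}(\boldsymbol{s}|_e)$. $\mathfrak{I}$ is loopblind if for every $k\in\mathbb{Z}_{>0}$ and every multisubset $A$ of $[k]=\{1,\dots,k\}$ such that $\Phi^{|A|}$ is not constant, there is a unique subset (i.e. a set without repetition) $A'\subseteq A$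 such that $\Phi^{|A|}(\boldsymbol{s}|_A)=\Phi^{|A'|}(\boldsymbol{s}|_{A'})$ for all $\boldsymbol{s}\in S^k$. For a model $\mathcal{M}$ with interaction functions $\{\phi^e\}_{e\in E}$ and a parameter vector $\boldsymbol{g}=(g_e)_{e\in E}\in\mathbb{C}^{|E|}$ such that $g_e\phi^e(\boldsymbol{s})\in\mathbb{R}$ for all states $\boldsymbol{s}$, the maximum-entropy distribution is $p(\boldsymbol{s}\mid\mathcal{M},\boldsymbol{g})=\frac{1}{Z(\mathcal{M};\boldsymbol{g})}\prod_{e\in E}\exp(g_e\phi^e(\boldsymbol{s}))$, where $Z(\mathcal{M};\boldsymbol{g})=\sum_{\boldsymbol{s}\in S^{|V|}}\prod_{e\in E}\exp(g_e\phi^e(\boldsymbol{s}))$. *)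

(* Defs.v *)
From HB Require Import structures.
From mathcomp Require Import all_boot all_order all_algebra perm.
From mathcomp Require Import finmap multiset.
From mathcomp Require Import complex reals sequences trigo.

Set Implicit Arguments.
Unset Strict Implicit.
Unset Printing Implicit Defensive.

Import Order.TTheory GRing.Theory Num.Theory.

Local Open Scope ring_scope.
Local Open Scope complex_scope.

(* Neither complex.v nor MathComp-Analysis provides the complex exponential:
   exp (a + ib) = e^a (cos b + i sin b). *)
Definition expC (R : realType) (z : R[i]) : R[i] :=
  (expR (complex.Re z) * cos (complex.Im z)) +i*
  (expR (complex.Re z) * sin (complex.Im z)).

Definition repetition_free (T : choiceType) (A : {mset T}%mset) : Prop :=
  forall x : T, (A x <= 1)%N.

(* The multiset of hyperedges is a finite family of multisets of vertices,
   indexed by E, so that repeated hyperedges carry their own parameter. *)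
Definition hypergraph (V E : finType) := E -> {mset V}%mset.

Definition loop (V E : finType) (G : hypergraph V E) (e : E) : Prop :=
  exists v : V, (1 < G e v)%N.

Definition loopless (V E : finType) (G : hypergraph V E) : Prop :=
  forall e : E, ~ loop G e.

Record interaction_family (R : realType) (S : finType) := InteractionFamily {
  interaction : forall k : nat, k.-tuple S -> R[i];
  interaction_sym : forall (k : nat) (t : k.-tuple S) (sigma : 'S_k),
    interaction [tuple tnth t (sigma i) | i < k] = interaction t
}.

(* Phi^{|A|}(s|_A). The order in which the elements of A are listed is
   irrelevant by interaction_sym. *)
Definition interaction_at (R : realType) (S : finType)
    (I : interaction_family R S) (T : finType) (A : {mset T}%mset)
    (s : {ffun T -> S}) : R[i] :=
  interaction I [tuple of map s (in_tuple (enum_mset A))].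

Definition constant_interaction (R : realType) (S : finType)
    (I : interaction_family R S) (k : nat) : Prop :=
  exists c : R[i], forall t : k.-tuple S, interaction I t = c.

Definition loopblind (R : realType) (S : finType)
    (I : interaction_family R S) : Prop :=
  forall (k : nat) (A : {mset 'I_k}%mset),
    (0 < k)%N ->
    ~ constant_interaction I (size (enum_mset A)) ->
    exists! A' : {mset 'I_k}%mset,
      [/\ repetition_free A', (A' `<=` A)%mset &
          forall s : {ffun 'I_k -> S},
            interaction_at I A s = interaction_at I A' s].

Definition model (R : realType) (S V E : finType) :=
  E -> {ffun V -> S} -> R[i].

Definition induced_model (R : realType) (S V E : finType)
    (G : hypergraph V E) (I : interaction_family R S) : model R S V E :=
  fun e s => interaction_at I (G e) s.

Definition admissible (R : realType) (S V E : finType)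
    (M : model R S V E) (g : E -> R[i]) : Prop :=
  forall (e : E) (s : {ffun V -> S}), g e * M e s \is Num.real.

Definition boltzmann_weight (R : realType) (S V E : finType)
    (M : model R S V E) (g : E -> R[i]) (s : {ffun V -> S}) : R[i] :=
  \prod_(e : E) expC (g e * M e s).

Definition partition_function (R : realType) (S V E : finType)
    (M : model R S V E) (g : E -> R[i]) : R[i] :=
  \sum_(s : {ffun V -> S}) boltzmann_weight M g s.

Definition maxent (R : realType) (S V E : finType)
    (M : model R S V E) (g : E -> R[i]) (s : {ffun V -> S}) : R[i] :=
  (partition_function M g)^-1 * boltzmann_weight M g s.

(* Main.v *)
Require Import Defs.
From mathcomp Require Import all_boot all_order all_algebra.
From mathcomp Require Import finmap multiset.
From mathcomp Require Import complex reals.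
From mathcomp Require Import boolp perm exp trigo.

(** Each hyperedge can be treated separately.  If the interaction of a
    hyperedge [e] depends on its arguments, loopblindness, carried from the
    index set ['I_k] to the vertex set along a bijection
    ([loopblind_transport]), supplies a repetition-free sub-multiset of [e]
    with the same interaction function.  If it is constant, [e] can be replaced
    by the empty hyperedge: the interaction function may then change, but only
    from one constant to another, and since the exponential never vanishes
    ([expC_neq0]) this multiplies all Boltzmann weights by one common nonzero
    factor.  Such a factor cancels against the partition function
    ([maxent_proportional]), so the distribution does not change. *)

Set Implicit Arguments.
Unset Strict Implicit.
Unset Printing Implicit Defensive.

Import Order.TTheory GRing.Theory.

Local Open Scope ring_scope.
Local Open Scope complex_scope.

(** The two arities are kept distinct because listings of permuted multisets
    have sizes that are only propositionally equal. *)
Lemma interaction_perm_eq (R : realType) (S : finType)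
    (I : interaction_family R S) (k l : nat)
    (t : k.-tuple S) (u : l.-tuple S) :
  perm_eq t u -> interaction I t = interaction I u.
Proof.
move=> tu; have kl : k = l by rewrite -(size_tuple t) (perm_size tu) size_tuple.
subst l; have /tuple_permP [p tE] := tu.
by rewrite -(interaction_sym I u p); congr interaction; apply: val_inj.
Qed.

Definition image_mset (T U : choiceType) (f : T -> U) (A : {mset T}%mset) :
  {mset U}%mset := seq_mset (map f (enum_mset A)).

Lemma size_image_mset (T U : choiceType) (f : T -> U) (A : {mset T}%mset) :
  size (enum_mset (image_mset f A)) = size (enum_mset A).
Proof. by rewrite (perm_size (perm_eq_seq_mset _)) size_map. Qed.

Lemma interaction_at_image (R : realType) (S : finType)
    (I : interaction_family R S) (T U : finType) (f : T -> U)
    (A : {mset T}%mset) (s : {ffun U -> S}) :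
  interaction_at I (image_mset f A) s =
  interaction_at I A [ffun x => s (f x)].
Proof.
apply: interaction_perm_eq => /=.
rewrite (perm_trans (perm_map s (perm_eq_seq_mset _))) // -map_comp.
by under [X in perm_eq _ X]eq_map do rewrite ffunE.
Qed.

Lemma repetition_free_image (T U : choiceType) (f : T -> U)
    (A : {mset T}%mset) :
  bijective f -> repetition_free A -> repetition_free (image_mset f A).
Proof.
move=> [g fK gK] rfA y; rewrite /image_mset mset_seqE count_map.
rewrite (@eq_count _ _ (pred1 (g y))); last first.
  by move=> x /=; rewrite -{1}(gK y) (can_eq fK).
by rewrite count_mem_mset.
Qed.

(** A non-constant interaction has positive arity, so [T] is inhabited here and
    loopblindness does apply to ['I_#|T|]. *)
Lemma loopblind_transport (R : realType) (S : finType)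
    (I : interaction_family R S) (T : finType) (A : {mset T}%mset) :
  loopblind I -> ~ constant_interaction I (size (enum_mset A)) ->
  exists2 B : {mset T}%mset, repetition_free B &
    forall s : {ffun T -> S}, interaction_at I A s = interaction_at I B s.
Proof.
move=> hI ncA.
have T_gt0 : (0 < #|T|)%N.
  rewrite lt0n; apply: contra_notN ncA => /eqP T0.
  have -> : enum_mset A = [::].
    by case: (enum_mset A) => // x l; have := fintype0 x T0.
  by exists (interaction I [tuple]) => t; rewrite tuple0.
pose A1 := image_mset (enum_rank : T -> 'I_#|T|) A.
have ncA1 : ~ constant_interaction I (size (enum_mset A1)).
  by rewrite size_image_mset.
have [B1 [[rfB1 _ AB1] _]] := hI _ A1 T_gt0 ncA1.
exists (image_mset (enum_val : 'I_#|T| -> T) B1).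
  apply: repetition_free_image => //.
  exact: enum_val_bij.
move=> s; rewrite interaction_at_image -AB1 interaction_at_image.
congr interaction_at; apply/ffunP => x.
by rewrite !ffunE enum_rankK.
Qed.

Lemma interaction_at_constant (R : realType) (S : finType)
    (I : interaction_family R S) (T : finType) (A : {mset T}%mset) :
  constant_interaction I (size (enum_mset A)) ->
  exists c, forall s : {ffun T -> S}, interaction_at I A s = c.
Proof. by move=> [c Ac]; exists c => s; apply: Ac. Qed.

(** The modulus is [expR] of the real part: [cos] and [sin] have no common
    zero. *)
Lemma expC_neq0 (R : realType) (z : R[i]) : expC z != 0.
Proof.
rewrite /expC eq_complex /= !mulf_eq0 !(gt_eqF (expR_gt0 _)) /=.
apply/negP => /andP[/eqP c0 /eqP s0].
have := cos2Dsin2 (complex.Im z); rewrite c0 s0 expr0n addr0 => /eqP.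
by rewrite eq_sym oner_eq0.
Qed.

Lemma maxent_proportional (R : realType) (S V E : finType)
    (M N : model R S V E) (g : E -> R[i]) (r : R[i]) :
  r != 0 ->
  (forall s, boltzmann_weight M g s = r * boltzmann_weight N g s) ->
  forall s, maxent M g s = maxent N g s.
Proof.
move=> r0 MN s; rewrite /maxent /partition_function.
under eq_bigr do rewrite MN.
by rewrite -mulr_sumr MN invfM mulrACA mulVf // mul1r.
Qed.

Lemma boltzmann_weight_proportional (R : realType) (S V E : finType)
    (M N : model R S V E) (g : E -> R[i]) :
  (forall e, exists2 r, r != 0 &
     forall s, expC (g e * M e s) = r * expC (g e * N e s)) ->
  exists2 r, r != 0 &
    forall s, boltzmann_weight M g s = r * boltzmann_weight N g s.
Proof.
move=> /fin_all_exists2 [r r0 MN].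
exists (\prod_e r e); first exact/prodf_neq0.
by move=> s; rewrite /boltzmann_weight -big_split; apply: eq_bigr => e _.
Qed.

(** The factor [r] is what lets the empty multiset stand in for one with a
    constant interaction, where the two constants may differ; it depends on the
    parameter [x] but not on the state. *)
Lemma loopblind_repetition_free (R : realType) (S : finType)
    (I : interaction_family R S) (T : finType) (A : {mset T}%mset) :
  loopblind I ->
  exists2 B : {mset T}%mset, repetition_free B &
    forall x : R[i], exists2 r, r != 0 & forall s : {ffun T -> S},
      expC (x * interaction_at I A s) = r * expC (x * interaction_at I B s).
Proof.
move=> hI.
have [cA|ncA] := EM (constant_interaction I (size (enum_mset A))); last first.
  have [B rfB AB] := loopblind_transport hI ncA.
  exists B => // x; exists 1; first exact: oner_neq0.
  by move=> s; rewrite AB mul1r.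
have [c Ac] := interaction_at_constant cA.
have [d Bd] : exists d, forall s : {ffun T -> S},
    interaction_at I (mset0 : {mset T}%mset) s = d.
  apply: interaction_at_constant; rewrite enum_mset0.
  by exists (interaction I [tuple]) => t; rewrite tuple0.
exists mset0; first by move=> v; rewrite mset0E.
move=> x; exists (expC (x * c) / expC (x * d)).
  by rewrite mulf_neq0 ?invr_eq0 ?expC_neq0.
by move=> s; rewrite Ac Bd divfK ?expC_neq0.
Qed.

Theorem proposition2p29 (R : realType) (S : finType)
    (I : interaction_family R S) (hI : loopblind I)
    (V E : finType) (G : hypergraph V E) :
  exists Gbar : hypergraph V E,
    loopless Gbar /\
    forall g : E -> R[i],
      admissible (induced_model G I) g ->
      forall s : {ffun V -> S},
        maxent (induced_model G I) g s = maxent (induced_model Gbar I) g s.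
Proof.
have [Gbar rfG GG] := fin_all_exists2
  (fun e => loopblind_repetition_free (G e) hI).
exists Gbar; split.
  by move=> e [v]; rewrite ltnNge rfG.
move=> g _.
have [|r r0 MN] := @boltzmann_weight_proportional R S V E
  (induced_model G I) (induced_model Gbar I) g.
  by move=> e; apply: GG.
exact: maxent_proportional r0 MN.
Qed.
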